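(* Let $V$ be a finite-dimensional real vector space with a (sufficiently) smooth norm $\|\cdot\|$ with unit ball $B$, such that the dual norm $\|\cdot\|_*$ on $V^*$ is also (sufficiently) smooth, and let $B^\circ\subset V^*$ be the unit ball of $\|\cdot\|_*$. Let $K\subset V$ be a convex body covered by a finite set of planks $P_1,\dots,P_m$ with widths (measured in $\|\cdot\|$) $w_1,\dots,w_m$, and put $w=\sum_{i=1}^m w_i$. Suppose that unit normals $n_i\in V^*$ of the planks $P_i$ can be chosen so that for every sequence of non-negative coefficients $c_1,\dots,c_m$, at least one of which equals $1$, $$\Big\|\sum_{i=1}^m c_i n_i\Big\|_*\ge 1 .$$ Then $e(K\times B^\circ)\le 2w$, where $e$ is the displacement energy in $V\times V^*$.
   Context: A convex body is a compact convex set with nonempty interior. A plank in $V$ is a closed region between a pair of parallel hyperplanes; its width is the distance between these hyperplanes in the norm $\|\cdot\|$. A unit normal of a plank $P$ is an element $n\in V^*$ with $\|n\|_*=1$ such that the bounding hyperplanes of $P$ have the form $\{x\in V:\langle n,x\rangle=\mathrm{const}\}$; each plank has exactly two unit normals, $\pm n$. The space $V\times V^*$ carries the symplectic form $\omega((x_1,y_1),(x_2,y_2))=\langle x_1,y_2\rangle-\langle x_2,y_1\rangle$. For a smooth compactly supported time-dependent Hamiltonian $H(x,y,t)$ on $V\times V^*\times[T_1,T_2]$ its total oscillation is $$\|H\|=\int_{T_1}^{T_2}\Big(\sup_{x,y}H(x,y,t)-\inf_{x,y}H(x,y,t)\Big)\,dt .$$ Let $\phi_t$ be the Hamiltonian flow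 of $H$, with $\phi_{T_1}=\mathrm{id}$. The displacement energy $e(X)$ of $X\subset V\times V^*$ is the infimum of $\|H\|$ over all such $H$ (and all $[T_1,T_2]$) with $X\cap\phi_{T_2}(X)=\emptyset$. *)

(* Defs.v *)
From HB Require Import structures.
From mathcomp Require Import all_boot all_order all_algebra.
From mathcomp Require Import all_classical all_reals all_analysis.

Set Implicit Arguments.
Unset Strict Implicit.
Unset Printing Implicit Defensive.

Import Order.TTheory GRing.Theory Num.Theory.
Import numFieldNormedType.Exports.
Import VectorInternalTheory.

Local Open Scope classical_set_scope.
Local Open Scope ring_scope.

(* Finite-dimensional normed spaces: the topology is the one of the norm, and
   finite dimension comes from [Vector]. *)
#[short(type="normedVectType")]
HB.structure Definition NormedVector (R : numFieldType) :=
  {V of NormedModule R V & Vector R V}.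

Section Dual.
Context {R : realType} (V : normedVectType R).

Definition dual : Type := 'Hom(V, R^o).

HB.instance Definition _ := Vector.copy dual 'Hom(V, R^o).

Definition pairing (x : V) (y : dual) : R := (y : 'Hom(V, R^o)) x.

Definition dual_norm (y : dual) : R :=
  sup [set `|pairing x y| | x in [set x : V | `|x| <= 1]].

(* [dual_norm] is a norm; finite dimension is used to bound the supremum. *)

Let r2v : {linear 'rV[R]_(dim V) -> V} := @r2v R V.
Let v2r : {linear V -> 'rV[R]_(dim V)} := @v2r R V.

Fact lipschitz_norm_continuous (E : normedModType R) (f : E -> R) (C : R) :
  0 <= C -> (forall u v, `|f u - f v| <= C * `|u - v|) -> continuous f.
Proof.
move=> C0 fC u; apply/cvgrPdist_le => e e0; near=> v.
apply: le_trans (fC _ _) _.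
have : `|u - v| <= e / (C + 1).
  near: v; apply/nbhs_normP; exists (e / (C + 1)) => /=.
    by rewrite divr_gt0// ltr_wpDl.
  by move=> v /=; exact: ltW.
rewrite ler_pdivlMr ?ltr_wpDl// => /(le_trans _); apply.
by rewrite mulrC ler_wpM2l// lerDl.
Unshelve. all: by end_near. Qed.

Fact r2v_lipschitz : exists2 C : R, 0 <= C &
  forall u : 'rV[R]_(dim V), `|r2v u| <= C * `|u|.
Proof.
exists (\sum_(i < dim V) `|r2v (delta_mx 0 i)|); first exact: sumr_ge0.
move=> u; rewrite {1}(row_sum_delta u) linear_sum mulr_suml.
apply: (le_trans (ler_norm_sum _ _ _)); apply: ler_sum => i _.
rewrite linearZ normrZ mulrC ler_wpM2l//.
by rewrite [leRHS]mx_normrE; apply: le_trans (le_bigmax _ _ (0, i)).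
Qed.

Fact v2r_lipschitz : exists2 C : R, 0 <= C & forall x : V, `|v2r x| <= C * `|x|.
Proof.
have [C C0 hC] := r2v_lipschitz.
have r2v0 u : r2v u = 0 -> u = 0.
  by move=> u0; rewrite -[u](@r2vK R V) -/(r2v u) u0 linear0.
have cg : continuous (fun u : 'rV[R]_(dim V) => `|r2v u|).
  apply: (@lipschitz_norm_continuous 'rV[R]_(dim V) _ C) => // u v.
  by apply: le_trans (ler_dist_dist _ _) _; rewrite -linearB.
pose S := [set u : 'rV[R]_(dim V) | `|u| = 1].
have cS : compact S.
  apply: bounded_closed_compact.
    exists 1; split; first exact: num_real.
    by move=> M M1 u /= ->; apply: ltW.
  rewrite (_ : S = Num.norm @^-1` [set 1]) //; apply: closed_comp.
    by move=> u _; exact: norm_continuous.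
  exact: closed_eq.
have [S0|/set0P[u0 Su0]] := eqVneq S set0.
  exists 0 => // x; rewrite mul0r normr_le0.
  have [//|x0] := eqVneq (v2r x) 0.
  suff : S (`|v2r x|^-1 *: v2r x) by rewrite S0.
  by rewrite /S/= normrZ normfV normr_id mulVf// normr_eq0.
have [c /set_mem Sc hc] := compact_EVT_min (ex_intro _ u0 Su0) cS
  (continuous_subspaceT cg).
have c0 : 0 < `|r2v c|.
  rewrite normr_gt0; apply/eqP => /r2v0 c0.
  by move: Sc; rewrite /S /= c0 normr0 => /esym/eqP; rewrite oner_eq0.
exists (`|r2v c|^-1); first by rewrite invr_ge0.
move=> x; rewrite mulrC ler_pdivlMr//.
have [->|x0] := eqVneq (v2r x) 0; first by rewrite normr0 mul0r.
have v0 : 0 < `|v2r x| by rewrite normr_gt0.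
have := hc (`|v2r x|^-1 *: v2r x).
rewrite inE /S /= normrZ normfV normr_id mulVf ?gt_eqF// => /(_ erefl).
rewrite linearZ normrZ normfV normr_id.
rewrite [r2v (v2r x)](@v2rK R V).
by rewrite ler_pdivlMl.
Qed.

Fact pairing_bounded (y : dual) :
  exists2 C : R, 0 <= C & forall x : V, `|pairing x y| <= C * `|x|.
Proof.
have [C C0 hC] := v2r_lipschitz.
pose D := \sum_(i < dim V) `|pairing (r2v (delta_mx 0 i)) y|.
have D0 : 0 <= D by exact: sumr_ge0.
exists (D * C); first exact: mulr_ge0.
move=> x; rewrite -{1}[x](@v2rK R V) -/(r2v _).
rewrite (row_sum_delta (v2r x)) linear_sum /pairing linear_sum -mulrA.
apply: (le_trans (ler_norm_sum _ _ _)).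
apply: (@le_trans _ _ (D * `|v2r x|)); last by rewrite ler_wpM2l.
rewrite mulr_suml; apply: ler_sum => i _.
rewrite !linearZ normrZ mulrC ler_wpM2l//.
by rewrite [leRHS]mx_normrE; apply: le_trans (le_bigmax _ _ (0, i)).
Qed.

Let dual_norm_set (y : dual) := [set `|pairing x y| | x in [set x : V | `|x| <= 1]].

Let dual_norm_has_sup (y : dual) : has_sup (dual_norm_set y).
Proof.
split; first by exists `|pairing 0 y|; exists 0 => //=; rewrite normr0.
have [C C0 hC] := pairing_bounded y.
exists C => _ [x /= x1 <-]; apply: le_trans (hC x) _.
by rewrite -[leRHS]mulr1 ler_wpM2l.
Qed.

Let dual_norm_ub (y : dual) x : `|x| <= 1 -> `|pairing x y| <= dual_norm y.
Proof. by move=> x1; apply: sup_upper_bound (dual_norm_has_sup y) _ _; exists x. Qed.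

Let dual_norm_le (y : dual) c : (forall x, `|x| <= 1 -> `|pairing x y| <= c) ->
  dual_norm y <= c.
Proof.
move=> h; apply: ge_sup; first by case: (dual_norm_has_sup y).
by move=> _ [x /= x1 <-]; exact: h.
Qed.

Let dual_normD (y z : dual) : dual_norm (y + z) <= dual_norm y + dual_norm z.
Proof.
apply: dual_norm_le => x x1; rewrite /pairing add_lfunE.
by apply: le_trans (ler_normD _ _) _; apply: lerD; exact: dual_norm_ub.
Qed.

Let dual_normZ_le (l : R) (y : dual) : dual_norm (l *: y) <= `|l| * dual_norm y.
Proof.
apply: dual_norm_le => x x1; rewrite /pairing scale_lfunE normrZ.
by rewrite ler_wpM2l//; exact: dual_norm_ub.
Qed.

Let dual_normZ (l : R) (y : dual) : dual_norm (l *: y) = `|l| * dual_norm y.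
Proof.
apply/eqP; rewrite eq_le dual_normZ_le /=.
have [->|l0] := eqVneq l 0.
  rewrite normr0 mul0r.
  by apply: le_trans (dual_norm_ub (0 *: y) (x := 0) _); rewrite ?normr0.
rewrite -ler_pdivlMl ?normr_gt0// -normfV.
by apply: le_trans (dual_normZ_le _ _); rewrite scalerA mulVf// scale1r.
Qed.

Let dual_norm_eq0 (y : dual) : dual_norm y = 0 -> y = 0.
Proof.
move=> y0; apply/lfunP => x; rewrite zero_lfunE.
have [->|x0] := eqVneq x 0; first by rewrite linear0.
have nx0 : `|x| != 0 by rewrite normr_eq0.
have : `|pairing (`|x|^-1 *: x) y| <= 0.
  by rewrite -y0 dual_norm_ub// normrZ normfV normr_id mulVf.
rewrite normr_le0 /pairing linearZ scaler_eq0 invr_eq0 (negbTE nx0) /=.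
by move/eqP.
Qed.

HB.instance Definition _ :=
  Lmodule_isNormed.Build R dual dual_normD dual_normZ dual_norm_eq0.

Lemma dual_normE (y : dual) : `|y| = dual_norm y.
Proof. by []. Qed.

End Dual.

(* Functions of class C^k on an open subset U of a finite-dimensional normed
   space: f is C^(k+1) when it is differentiable on U and, for every fixed
   vector v, x |-> df_x(v) is C^k on U. *)
Fixpoint class_C {R : realType} {E : normedModType R} (k : nat) (U : set E)
    (f : E -> R) : Prop :=
  match k with
  | 0 => forall x, U x -> {for x, continuous f}
  | k'.+1 => (forall x, U x -> differentiable f x) /\
             forall v, class_C k' U (fun x => 'd f x v)
  end.

Definition smooth {R : realType} {E : normedModType R} (f : E -> R) : Prop :=
  forall k, class_C k setT f.

(* A norm is not differentiable at 0, so its smoothness is meant off 0. *)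
Definition smooth_norm {R : realType} (k : nat) (E : normedModType R) : Prop :=
  class_C k [set x : E | x != 0] (fun x : E => `|x|).

Section Planks.
Context {R : realType} {V : normedVectType R}.

Definition convex_body (K : set V) : Prop :=
  [/\ compact K, convex_set K & interior K !=set0].

Definition dual_ball : set (dual V) := [set y | `|y| <= 1].

Definition hyperplane (y : dual V) (c : R) : set V := [set x | pairing x y = c].

(* The closed region between two parallel hyperplanes; the direction is not
   normalized. *)
Record plank := Plank {
  plank_dir : dual V;
  plank_lo : R;
  plank_hi : R;
  plank_dir_neq0 : plank_dir != 0;
  plank_lo_le_hi : plank_lo <= plank_hi }.

Definition plank_lower (P : plank) : set V := hyperplane (plank_dir P) (plank_lo P).
Definition plank_upper (P : plank) : set V := hyperplane (plank_dir P) (plank_hi P).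

Definition plank_set (P : plank) : set V :=
  [set x | plank_lo P <= pairing x (plank_dir P) <= plank_hi P].

Definition plank_width (P : plank) : R :=
  inf [set `|x - x'| | x in plank_lower P & x' in plank_upper P].

Definition unit_normal (P : plank) (y : dual V) : Prop :=
  [/\ `|y| = 1,
      exists c, plank_lower P = hyperplane y c &
      exists c, plank_upper P = hyperplane y c].

End Planks.
Arguments plank {R} V.
Arguments dual_ball {R} V.

Section Hamiltonian.
Context {R : realType} {V : normedVectType R}.

Notation phase := (V * dual V)%type.
Implicit Types (H : phase -> R -> R) (phi : R -> phase -> phase).

Definition omega (z1 z2 : phase) : R := pairing z1.1 z2.2 - pairing z2.1 z1.2.

(* A Hamiltonian on V x V* x [T1, T2] is represented by a smooth function
   defined for all times; only its values for t in [T1, T2] matter. *)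
Definition smooth_hamiltonian H : Prop :=
  smooth (fun p : phase * R => H p.1 p.2).

Definition compactly_supported H (T1 T2 : R) : Prop :=
  exists2 C : set phase, compact C &
    forall z t, t \in `[T1, T2] -> ~ C z -> H z t = 0.

Definition total_oscillation H (T1 T2 : R) : \bar R :=
  (\int[lebesgue_measure]_(t in `[T1, T2])
     (sup (range (H ^~ t)) - inf (range (H ^~ t)))%R%:E)%E.

(* Sign convention: omega(X_H, v) = dH(v), that is x' = dH/dy, y' = - dH/dx.
   The opposite convention replaces H by - H, which has the same total
   oscillation. At T1 and T2 only continuity of the trajectories is required;
   one-sided differentiability there follows. *)
Definition hamiltonian_flow H (T1 T2 : R) phi : Prop :=
  [/\ forall z, phi T1 z = z,
      forall z, {within `[T1, T2], continuous (phi ^~ z)} &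
      forall z t, t \in `]T1, T2[ ->
        derivable (phi ^~ z) t 1 /\
        forall v, omega (derive1 (phi ^~ z) t) v = 'd (H ^~ t) (phi t z) v].

Definition displaces H (T1 T2 : R) (X : set phase) : Prop :=
  exists2 phi, hamiltonian_flow H T1 T2 phi & X `&` (phi T2 @` X) = set0.

Definition displacement_energy (X : set phase) : \bar R :=
  ereal_inf [set e | exists H T1 T2,
    [/\ T1 < T2, smooth_hamiltonian H, compactly_supported H T1 T2,
        displaces H T1 T2 X & e = total_oscillation H T1 T2]].

End Hamiltonian.

(* Main.v *)
Require Import Defs.
From HB Require Import structures.
From mathcomp Require Import all_boot all_order all_algebra.
From mathcomp Require Import all_classical all_reals all_analysis.
From mathcomp Require Import ring lra.
Import Order.TTheory GRing.Theory Num.Theory.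
Import numFieldNormedType.Exports.
Import VectorInternalTheory.
Local Open Scope classical_set_scope.
Local Open Scope ring_scope.
Set Implicit Arguments.
Unset Strict Implicit.
Unset Printing Implicit Defensive.

(** A Hamiltonian F(x) that depends on the position only generates the shear
    (x, y) |-> (x, y - t dF(x)). If |dF(x)| > 2 for every x in K, the time-one
    shear moves every fibre {x} x B° off itself, since B° has diameter 2 for
    the dual norm, and so it displaces K x B°.

    Each plank P_i is contained in a strip a_i <= <n_i, x> <= b_i with
    b_i - a_i <= w_i ([plank_strip]). Let h_i be a smooth nondecreasing function
    on the line with slope 1 on [a_i, b_i] whose range has length
    b_i - a_i + 4d ([smooth_clamp]), and let F(x) be the sum of the
    l h_i(<n_i, x>) for some l > 2. The gradient of F at x is l times the sum of
    the h_i'(<n_i, x>) n_i, a combination with nonnegative coefficients, one of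
    which is 1 when x lies in one of the planks; the hypothesis on the normals
    then gives |dF(x)| >= l on K. The oscillation of F is at most the sum of the
    l (w_i + 4d) ([displacement_energy_strips]), which tends to 2w as l tends to
    2 and d to 0.

    It remains to make the Hamiltonian compactly supported
    ([displacement_energy_potential]). F is multiplied by a smooth cutoff with
    values in [0, 1] that is 1 near the compact set swept by K x B° under the
    shear; F takes its values in an interval [0, A], hence so does the product.
    Trajectories starting in K x B° are unchanged. A flow must also provide a
    trajectory from every other point, but there existence is enough: it follows from Peano's theorem ([peano_existence]),
    as the Hamiltonian vector field is continuous and bounded and closed balls
    of phase space are compact. *)

(** * Closure properties of C^k functions *)

Section ClassC.
Context {R : realType} {E : normedModType R}.
Implicit Types (f g : E -> R).

(** The common induction step of the closure lemmas: with the differential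
    given by a formula in which f and its differential occur, the induction
    hypothesis applies to that formula. *)
Lemma class_CS_is_diff k f (df : E -> E -> R) :
  (forall x, is_diff x f (df x)) -> (forall v, class_C k setT (df ^~ v)) ->
  class_C k.+1 setT f.
Proof.
move=> fdf dfk; split=> [x _|v]; first by have [] := fdf x.
rewrite (_ : (fun x => _) = df ^~ v) //.
by apply/funext => x; have [_ ->] := fdf x.
Qed.

Lemma class_C_pred k f : class_C k.+1 setT f -> class_C k setT f.
Proof.
elim: k f => [f [df _] x _|k IH f [df dfk]].
  exact/differentiable_continuous/df.
by split=> // v; exact/IH/dfk.
Qed.

Lemma class_C_is_diff k f : class_C k.+1 setT f -> forall x, is_diff x f ('d f x).
Proof. by move=> [df _] x; apply: DiffDef => //; exact: df. Qed.

Lemma class_C_continuous k f : class_C k setT f -> continuous f.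
Proof.
elim: k => [cf x|k IH /class_C_pred/IH//]; exact: cf.
Qed.

Lemma class_C_cst k (c : R) : class_C k setT (fun _ : E => c).
Proof.
elim: k c => [c x _|k IH c]; first exact: cst_continuous.
by apply: (@class_CS_is_diff _ _ (fun _ _ => 0)) => v; exact: IH.
Qed.

Lemma class_CD k f g : class_C k setT f -> class_C k setT g ->
  class_C k setT (fun x => f x + g x).
Proof.
elim: k f g => [f g cf cg x _|k IH f g fk gk].
  by apply: continuousD; [exact: cf|exact: cg].
apply: (@class_CS_is_diff _ _ (fun x v => 'd f x v + 'd g x v)) => [x|v].
  exact: is_diffD (class_C_is_diff fk x) (class_C_is_diff gk x).
by apply: IH; [exact: fk.2|exact: gk.2].
Qed.

Lemma class_CM k f g : class_C k setT f -> class_C k setT g ->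
  class_C k setT (fun x => f x * g x).
Proof.
elim: k f g => [f g cf cg x _|k IH f g fk gk].
  by apply: continuousM; [exact: cf|exact: cg].
apply: (@class_CS_is_diff _ _ (fun x v => f x * 'd g x v + g x * 'd f x v)) => [x|v].
  exact: is_diffM (class_C_is_diff fk x) (class_C_is_diff gk x).
by apply: class_CD; apply: IH; do ?[exact: class_C_pred|exact: fk.2|exact: gk.2].
Qed.

Lemma class_CB k f g : class_C k setT f -> class_C k setT g ->
  class_C k setT (fun x => f x - g x).
Proof.
move=> fk gk; under eq_fun do rewrite -[- g _]mulN1r.
by apply: class_CD => //; apply: class_CM => //; exact: class_C_cst.
Qed.

Lemma class_C_sum k (I : Type) (r : seq I) (f : I -> E -> R) :
  (forall i, class_C k setT (f i)) -> class_C k setT (fun x => \sum_(i <- r) f i x).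
Proof.
move=> fk; elim: r => [|i r IH].
  by under eq_fun do rewrite big_nil; exact: class_C_cst.
by under eq_fun do rewrite big_cons; exact: class_CD.
Qed.

End ClassC.

Section ClassCComp.
Context {R : realType} {E : normedModType R}.
Implicit Types (f g : E -> R).

(** On the line, the differential of g at y is multiplication by its value at
    1, so the chain rule presents the differential of g o f as a product. *)
Lemma class_C_comp k (g : R -> R) f : class_C k setT g -> class_C k setT f ->
  class_C k setT (g \o f).
Proof.
elim: k g f => [g f cg cf x _|k IH g f gk fk].
  by apply: continuous_comp; [exact: cf|exact: cg].
apply: (@class_CS_is_diff _ _ _ _ (fun x v => 'd f x v * 'd g (f x) 1)) => [x|v].
  have /is_diff_eq := is_diff_comp (class_C_is_diff fk x) (class_C_is_diff gk (f x)).
  apply; apply/funext => v /=.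
  by rewrite -[X in 'd g (f x) X = _]mulr1 [LHS]linearZ.
apply: class_CM; first exact: fk.2.
by apply: (IH (fun y => 'd g y 1) f); [exact: gk.2|exact: class_C_pred].
Qed.

Lemma class_CV k f : (forall x, f x != 0) -> class_C k setT f ->
  class_C k setT (fun x => (f x)^-1).
Proof.
move=> f0; elim: k => [cf x _|k IH fk].
  by apply: continuousV => //; exact: cf.
apply: (@class_CS_is_diff _ _ _ _ (fun x v => - 1 * ((f x)^-1 * (f x)^-1) * 'd f x v)) => [x|v].
  apply: DiffDef; first by apply: differentiableV => //; exact: fk.1.
  rewrite diffV//; last exact: fk.1.
  by apply/funext => v /=; rewrite mulN1r expr2 invfM.
apply: class_CM; last exact: fk.2.
by apply: class_CM; [exact: class_C_cst|apply: class_CM; apply: IH; exact: class_C_pred].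
Qed.

End ClassCComp.

Lemma linear_is_diff (R : realType) (E F : normedModType R) (L : {linear E -> F}) x :
  continuous L -> is_diff x L L.
Proof. by move=> cL; apply: DiffDef; [exact: linear_differentiable|rewrite diff_lin]. Qed.

Lemma class_C_comp_linear (R : realType) (E F : normedModType R) k
  (L : {linear E -> F}) (f : F -> R) : continuous L -> class_C k setT f ->
  class_C k setT (f \o L).
Proof.
move=> cL; elim: k f => [f cf x _|k IH f fk].
  by apply: continuous_comp; [exact: cL|exact: cf].
apply: (@class_CS_is_diff _ _ _ _ (fun x v => 'd f (L x) (L v))) => [x|v].
  exact: is_diff_comp (linear_is_diff x cL) (class_C_is_diff fk (L x)).
exact: (IH (fun y => 'd f y (L v)) (fk.2 _)).
Qed.

Lemma class_C_linear (R : realType) (E : normedModType R) k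
  (L : {linear E -> R^o}) : continuous L -> class_C k setT (L : E -> R).
Proof.
move=> cL; case: k => [|k]; first by move=> x _; exact: cL.
apply: (@class_CS_is_diff _ _ _ _ (fun x v => L v)) => [x|v].
  exact: linear_is_diff.
exact: class_C_cst.
Qed.

Lemma class_C_id (R : realType) k : class_C k setT (@id R).
Proof. exact: (@class_C_linear _ _ k idfun (fun x => cvg_id)). Qed.

(** * Derivatives on the line *)

Lemma is_derive_le_near (R : realType) (E : normedModType R) (u : R -> E) (t : R)
    (d : E) :
  (forall e, 0 < e -> \forall s \near t, `|u s - u t - (s - t) *: d| <= e * `|s - t|) ->
  is_derive t 1 u d.
Proof.
move=> H.
have cv : h^-1 *: ((u \o shift t) (h *: 1) - u t) @[h --> 0^'] --> d.
  apply/cvgrPdist_le => e e0; near=> h.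
  have h0 : h != 0 by near: h; exact: nbhs_dnbhs_neq.
  rewrite /= [h *: 1]mulr1 -(ler_pM2l (_ : 0 < `|h|)) ?normr_gt0// -normrZ.
  have -> : h *: (d - h^-1 *: (u (h + t) - u t)) =
            - (u (h + t) - u t - (h + t - t) *: d).
    by rewrite scalerBr scalerA divff// scale1r [RHS]opprB addrK.
  rewrite normrN mulrC -[X in e * `|X|](addrK t).
  near: h; apply: nbhs_dnbhs.
  have := H e e0; rewrite -{1}[t](add0r t) => nt.
  have ct : (fun h => h + t) @ (0:R) --> (0 + t).
    exact: (@cvgD _ _ _ _ _ id (cst t)) cvg_id (cvg_cst _).
  exact: (ct _ nt).
split; first by apply/cvg_ex; exists d.
exact: cvg_lim.
Unshelve. all: by end_near. Qed.

Lemma is_diff_of_derive (R : realType) (f : R -> R) (x d : R) :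
  is_derive x 1 f d -> is_diff x f (fun v => d * v).
Proof.
move=> fd; have df : derivable f x 1 by [].
apply: DiffDef; first exact/derivable1_diffP.
rewrite deriv1E//; apply/funext => v.
by rewrite derive1E derive_val [LHS]mulrC.
Qed.

Lemma nondecreasing_derive_ge0 (R : realType) (f : R -> R) (x d : R) :
  {homo f : x y / x <= y} -> is_derive x 1 f d -> 0 <= d.
Proof.
move=> ndf [df <-]; apply: limr_ge => //; near=> h => /=.
rewrite [_ *: 1]mulr1 /GRing.scale/=.
have [h0|h0] := lerP 0 h.
  by rewrite mulr_ge0 ?invr_ge0// subr_ge0 ndf// lerDr.
by rewrite mulr_le0 ?invr_le0 ?(ltW h0)// subr_le0 ndf// gerDr ltW.
Unshelve. all: by end_near. Qed.

(** * Smooth clamps and cutoffs *)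

Section Bump.
Context {R : realType}.
Implicit Types (x s : R).

(** flat 0 is the classical smooth function that is flat at 0. The negative
    powers make the span of the family stable under differentiation, so that all
    its members are shown to be smooth at once. *)
Definition flat n x : R := if 0 < x then x^-1 ^+ n * expR (- x^-1) else 0.

Lemma flat_le0 n x : x <= 0 -> flat n x = 0.
Proof. by rewrite /flat ltNge => ->. Qed.

Lemma flat_ge0 n x : 0 <= flat n x.
Proof.
rewrite /flat; case: ifP => // x0.
by rewrite mulr_ge0 ?expR_ge0// exprn_ge0// invr_ge0 ltW.
Qed.

Lemma flat_gt0 n x : 0 < x -> 0 < flat n x.
Proof. by move=> x0; rewrite /flat x0 mulr_gt0 ?expR_gt0// exprn_gt0// invr_gt0. Qed.

(** The exponential series gives exp(1/x) >= x^-(n+2) / (n+2)!. The bound is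
    quadratic so as to give a zero derivative at 0. *)
Lemma flat_le_sqr n x : flat n x <= n.+2`!%:R * x ^+ 2.
Proof.
have [x0|x0] := leP x 0.
  by rewrite flat_le0// mulr_ge0// sqr_ge0.
rewrite /flat x0 expRN.
have u0 : 0 < x^-1 by rewrite invr_gt0.
rewrite ler_pdivrMr ?expR_gt0//.
have := expR_ge1Dxn n.+1 (ltW u0).
move=> /(le_trans (_ : _ <= _)) -/(_ (x^-1 ^+ n.+2 / n.+2`!%:R)).
rewrite lerDr ler01 => /(_ isT) le1.
apply: (@le_trans _ _ (n.+2`!%:R * x ^+ 2 * (x^-1 ^+ n.+2 / n.+2`!%:R))); last first.
  by rewrite ler_wpM2l// mulr_ge0// sqr_ge0.
have f0 : n.+2`!%:R != 0 :> R by rewrite pnatr_eq0 -lt0n fact_gt0.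
have x0' : x != 0 by rewrite gt_eqF.
rewrite (_ : x^-1 ^+ n.+2 = x^-1 ^+ 2 * x^-1 ^+ n); last by rewrite -exprD.
set a := x^-1 ^+ n; set c := _%:R in f0 *.
by rewrite le_eqVlt; apply/orP; left; apply/eqP; field; rewrite f0 x0'.
Qed.

Lemma is_derive_flat n x :
  is_derive x 1 (flat n) (flat n.+2 x - n%:R * flat n.+1 x).
Proof.
have [x0|x0|->] := ltgtP x 0.
- rewrite !flat_le0 ?(ltW x0)// mulr0 subr0.
  apply: (@near_eq_is_derive _ _ _ (cst 0)).
  by near=> y; rewrite flat_le0//; near: y; apply: filterS (lt_nbhsl x0) => z /ltW.
- have x0' : x != 0 by rewrite gt_eqF.
  suff D : is_derive x 1 (fun y : R => y^-1 ^+ n * expR (- y^-1))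
      (flat n.+2 x - n%:R * flat n.+1 x).
    apply: near_eq_is_derive D.
    by near=> y; rewrite /flat ifT//; near: y; exact: lt_nbhsr.
  have DV : is_derive x 1 (fun y : R => y^-1) (- x ^- 2 *: 1) by exact: is_deriveV.
  rewrite /flat x0.
  have DX : is_derive x 1 (fun y : R => y^-1 ^+ n) ((n%:R * x^-1 ^+ n.-1) *: (- x ^- 2 *: 1)).
    by have := is_deriveX n DV; rewrite exprfctE.
  have DN : is_derive x 1 (fun y : R => - y^-1) (- (- x ^- 2 *: 1)) by exact: is_deriveN.
  have DE : is_derive x 1 (fun y : R => expR (- y^-1)) (expR (- x^-1) * - (- x ^- 2 *: 1)).
    exact: (is_derive1_comp (is_derive_expR _) DN).
  apply: is_derive_eq (is_deriveM DX DE) _.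
  rewrite /GRing.scale/= !mulr1; case: n {DX} => [|n] /=.
    by rewrite expr0; field.
  rewrite !exprS; set a := x^-1 ^+ n; set b := expR _.
  by field.
- rewrite !flat_le0// mulr0 subr0.
  apply: is_derive_le_near => e e0; near=> s.
  rewrite scaler0 (flat_le0 _ (lexx 0)) !subr0 ger0_norm ?flat_ge0//.
  apply: le_trans (flat_le_sqr _ _) _.
  rewrite -real_normK ?num_real// expr2 mulrA ler_wpM2r//.
  rewrite mulrC -ler_pdivlMr ?ltr0n ?fact_gt0//.
  near: s; apply/nbhs_normP; exists (e / n.+2`!%:R) => /=.
    by rewrite divr_gt0// ltr0n fact_gt0.
  by move=> z /=; rewrite sub0r normrN => /ltW.
Unshelve. all: by end_near. Qed.

Lemma class_C_flat k n : class_C k setT (flat n).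
Proof.
elim: k n => [|k IH] n.
  move=> x _; apply: differentiable_continuous.
  by have [] := is_diff_of_derive (is_derive_flat n x).
apply: (class_CS_is_diff (fun x => is_diff_of_derive (is_derive_flat n x))) => v.
apply: class_CM; last exact: class_C_cst.
by apply: class_CB => //; apply: class_CM => //; exact: class_C_cst.
Qed.

Lemma flat_homo : {homo flat 0 : x y / x <= y}.
Proof.
move=> x y xy; have [x0|x0] := leP x 0; first by rewrite (flat_le0 _ x0) flat_ge0.
have y0 := lt_le_trans x0 xy.
by rewrite /flat x0 y0 !expr0 !mul1r ler_expR lerN2 lef_pV2.
Qed.

Definition step s : R := flat 0 s * (flat 0 s + flat 0 (1 - s))^-1.

Let den_gt0 s : 0 < flat 0 s + flat 0 (1 - s).
Proof.
have [s0|s0] := ltP 0 s.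
  by rewrite ltr_pwDl ?flat_gt0 ?flat_ge0.
by rewrite ltr_wpDl ?flat_ge0// flat_gt0// subr_gt0 (le_lt_trans s0).
Qed.

Lemma class_C_step k : class_C k setT step.
Proof.
have f0 := class_C_flat k 0.
apply: class_CM => //; apply: class_CV => [s|]; first by rewrite gt_eqF.
apply: class_CD => //; apply: (class_C_comp (f := fun s => 1 - s) f0).
by apply: class_CB; [exact: class_C_cst|exact: class_C_id].
Qed.

Lemma step_ge0 s : 0 <= step s.
Proof. by rewrite mulr_ge0 ?flat_ge0// invr_ge0 ltW. Qed.

Lemma step_le1 s : step s <= 1.
Proof. by rewrite ler_pdivrMr// mul1r lerDl flat_ge0. Qed.

Lemma step_le0 s : s <= 0 -> step s = 0.
Proof. by move=> s0; rewrite /step flat_le0// mul0r. Qed.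

Lemma step_ge1 s : 1 <= s -> step s = 1.
Proof.
move=> s1; rewrite /step (@flat_le0 _ (1 - s)) ?subr_le0// addr0 divff//.
by rewrite gt_eqF// flat_gt0// (lt_le_trans ltr01).
Qed.

Lemma step_homo : {homo step : x y / x <= y}.
Proof.
move=> x y xy; rewrite /step ler_pdivrMr// mulrAC ler_pdivlMr//.
rewrite mulrDr mulrDr mulrC lerD2l.
by rewrite ler_pM ?flat_ge0 ?flat_homo// lerD2l lerN2.
Qed.

(** A smooth version of the positive part of s, equal to it outside [0, e]. *)
Definition ramp e s : R := s * step (s / e).

Lemma ramp_homo e : 0 < e -> {homo ramp e : x y / x <= y}.
Proof.
move=> e0 x y xy; rewrite /ramp; have [x0|x0] := leP x 0.
  rewrite (@step_le0 (x / e)); last by rewrite pmulr_lle0 ?invr_gt0.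
  rewrite mulr0; have [y0|y0] := leP y 0.
    by rewrite step_le0 ?mulr0// pmulr_lle0 ?invr_gt0.
  by rewrite mulr_ge0 ?step_ge0// ltW.
by rewrite ler_pM ?step_ge0 ?(ltW x0)// step_homo// ler_pM2r ?invr_gt0.
Qed.

Lemma ramp_ge0 e s : 0 < e -> 0 <= ramp e s.
Proof.
move=> e0; rewrite /ramp; have [s0|s0] := leP s 0.
  by rewrite step_le0 ?mulr0// pmulr_lle0 ?invr_gt0.
by rewrite mulr_ge0 ?step_ge0// ltW.
Qed.

Lemma ramp_le e s : 0 < e -> ramp e s <= Num.max s 0.
Proof.
move=> e0; rewrite le_max; have [s0|s0] := leP s 0.
  by rewrite /ramp step_le0 ?mulr0 ?lexx ?orbT// pmulr_lle0 ?invr_gt0.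
by rewrite /ramp -[leRHS]mulr1 ler_pM2l// step_le1.
Qed.

Lemma ramp_id e s : 0 < e -> e <= s -> ramp e s = s.
Proof. by move=> e0 es; rewrite /ramp step_ge1 ?mulr1// ler_pdivlMr// mul1r. Qed.

Lemma class_C_ramp k e : class_C k setT (ramp e).
Proof.
have idk := @class_C_id R k.
apply: class_CM => //.
apply: (class_C_comp (g := step) (f := fun s => s / e)); first exact: class_C_step.
by apply: class_CM => //; exact: class_C_cst.
Qed.

(** Up to a constant, a truncation of the identity to [a - 2d, b + 2d]; one
    ramp truncates from below and a second, reflected one from above. Each
    margin of 2d is spent half on the ramp and half on having the identity on a
    neighbourhood of [a, b]. *)
Lemma smooth_clamp (a b d : R) : a <= b -> 0 < d ->
  exists h : R -> R, [/\ smooth h, {homo h : x y / x <= y},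
    forall x, 0 <= h x <= b - a + 4 * d &
    forall x, a - d < x < b + d -> h x = x - (a - 2 * d)].
Proof.
move=> ab d0; pose c := a - 2 * d; pose w := b - a + 4 * d.
have w0 : 0 <= w by rewrite /w; lra.
exists (fun x => w - ramp d (w - ramp d (x - c))); split.
- move=> k; have r := class_C_ramp k d.
  have wB f : class_C k setT f -> class_C k setT (fun x : R => w - ramp d (f x)).
    by move=> fk; apply: class_CB; [exact: class_C_cst|exact: class_C_comp r fk].
  by apply/wB/wB/class_CB; [exact: class_C_id|exact: class_C_cst].
- move=> x y xy; rewrite lerD2l lerN2 ramp_homo// lerD2l lerN2 ramp_homo//.
  by rewrite lerD2r.
- move=> x; rewrite subr_ge0 gerBl ramp_ge0// andbT.
  by rewrite (le_trans (ramp_le _ d0))// ge_max w0 gerBl ramp_ge0.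
- move=> x /andP[ax xb].
  by rewrite [ramp d (x - c)]ramp_id ?ramp_id// /w /c; lra.
Qed.

Lemma smooth_cutoff (B : R) : exists chi : R -> R, [/\ smooth chi,
    forall s, 0 <= chi s <= 1, forall s, s <= B -> chi s = 1 &
    forall s, B + 1 <= s -> chi s = 0].
Proof.
exists (fun s => step (B + 1 - s)); split=> [k|s|s sB|s Bs].
- apply: (class_C_comp (class_C_step k)).
  by apply: class_CB; [exact: class_C_cst|exact: class_C_id].
- by rewrite step_ge0 step_le1.
- by rewrite step_ge1//; lra.
- by rewrite step_le0//; lra.
Qed.

End Bump.

(** * Peano's existence theorem *)

Lemma ultra_fmap (T U : Type) (f : T -> U) (F : set_system T) :
  UltraFilter F -> UltraFilter (f @ F).
Proof.
move=> FU; split; first exact: fmap_proper_filter.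
move=> G GF sFG; rewrite predeqE => A; split; last exact: sFG.
move=> GA; have [//|FA] := in_ultra_setVsetC (f @^-1` A) FU.
have /sFG GAC : (f @ F) (~` A) by [].
have : G set0 by rewrite -(setICr A); exact: filterI.
by move/filter_not_empty.
Qed.

Section Peano.
Context {R : realType} {E : normedModType R}.
Context (f : E -> E) (M : R) (z : E).
Context (bounded_precompact :
  forall r, exists2 C : set E, compact C & [set x | `|x| <= r] `<=` C).
Context (f_continuous : continuous f).
Context (f_bounded : forall x, `|f x| <= M).

Definition euler_iter n k : E := iter k (fun x => x + n.+1%:R^-1 *: f x) z.

Definition euler_index n (t : R) : nat := Num.truncn (t * n.+1%:R).

(** The n-th Euler approximation has step 1/(n+1) and is piecewise constant
    in time, so that its increments are exactly sums of Euler steps. *)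
Definition euler n t : E := euler_iter n (euler_index n t).

Let h_gt0 n : 0 < n.+1%:R^-1 :> R. Proof. by rewrite invr_gt0. Qed.

(** As long as the field stays within e of p, the iterates follow the straight
    motion of velocity p. *)
Lemma euler_iter_drift n k J p (e : R) :
  (forall j, (j < J)%N -> `|f (euler_iter n (k + j)) - p| <= e) ->
  `|euler_iter n (k + J) - euler_iter n k - (J%:R * n.+1%:R^-1) *: p|
    <= J%:R * n.+1%:R^-1 * e.
Proof.
elim: J => [_|J IH fp].
  by rewrite addn0 subrr mul0r scale0r subrr normr0 mul0r.
have -> : euler_iter n (k + J.+1) - euler_iter n k - (J.+1%:R * n.+1%:R^-1) *: p
  = (euler_iter n (k + J) - euler_iter n k - (J%:R * n.+1%:R^-1) *: p)
    + n.+1%:R^-1 *: (f (euler_iter n (k + J)) - p).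
  rewrite addnS /= -/(euler_iter n (k + J)).
  rewrite -[J.+1%:R]natr1 mulrDl mul1r scalerDl scalerBr.
  set a := euler_iter _ _; set b := euler_iter _ k; set c := _ *: p; set d := _ *: p.
  set q := _ *: f a.
  by rewrite opprD !addrA; congr (_ - _); rewrite -!addrA; congr (_ + _);
     rewrite addrC -!addrA.
apply: le_trans (ler_normD _ _) _.
rewrite -[J.+1%:R]natr1 !mulrDl mul1r lerD//.
  by apply: IH => j jJ; apply: fp; exact: ltnW.
by rewrite normrZ gtr0_norm// ler_pM2l// fp.
Qed.

Lemma euler_iter_move n k J :
  `|euler_iter n (k + J) - euler_iter n k| <= J%:R * n.+1%:R^-1 * M.
Proof.
have := @euler_iter_drift n k J 0 M; rewrite scaler0 subr0; apply => j _.
by rewrite subr0.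
Qed.

Lemma euler_index_le n (a b : R) : a <= b -> (euler_index n a <= euler_index n b)%N.
Proof. by move=> ab; apply: le_truncn; rewrite ler_pM2r. Qed.

Lemma euler_index_dist n (a b : R) : 0 <= a -> 0 <= b ->
  `|((euler_index n b)%:R - (euler_index n a)%:R) * n.+1%:R^-1 - (b - a)|
    <= n.+1%:R^-1 :> R.
Proof.
move=> a0 b0; have n0 : 0 < n.+1%:R :> R by [].
have P (c : R) : 0 <= c -> (euler_index n c)%:R * n.+1%:R^-1 <= c
    < (euler_index n c)%:R * n.+1%:R^-1 + n.+1%:R^-1.
  move=> c0; have /truncn_itv : 0 <= c * n.+1%:R by rewrite mulr_ge0.
  rewrite -[X in _ < _ + X]mul1r -mulrDl natr1.
  by rewrite ler_pdivrMr// ltr_pdivlMr.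
move: (P _ a0) (P _ b0) => /andP[Ha Hb] /andP[Ha1 Hb1].
rewrite mulrBl ler_norml; set x := _ / _ in Ha Hb *. set y := _ / _ in Ha1 Hb1 *. set h := _^-1 in Hb Hb1 *.
apply/andP; split; lra.
Qed.

Section Limit.
Context (F : set_system nat) (FU : UltraFilter F) (FoO : \oo `<=` F).
Context (u : R -> E).
Context (euler_cvg : forall t, euler n t @[n --> F] --> u t).

(** The estimate [euler_iter_drift] in the limit. It yields both the continuity
    of u, with p = 0 and e = M, and its differentiability, with p = f(u t) and
    e arbitrarily small. *)
Lemma euler_limit_drift (a b : R) p (e : R) : 0 <= a <= b -> 0 <= e ->
  (\forall n \near F, forall j, (j < euler_index n b - euler_index n a)%N ->
    `|f (euler_iter n (euler_index n a + j)) - p| <= e) ->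
  `|u b - u a - (b - a) *: p| <= e * (b - a).
Proof.
move=> /andP[a0 ab] e0 fp; have b0 := le_trans a0 ab.
apply/ler_addgt0Pr => eta eta0; have eta20 : 0 < eta / 2 by rewrite divr_gt0.
have cv : euler n b - euler n a - (b - a) *: p @[n --> F] --> u b - u a - (b - a) *: p.
  by apply: cvgB; [apply: cvgB|exact: cvg_cst].
have c0 : 0 < (e + `|p| + 1) by rewrite ltr_wpDl// addr_ge0.
have hF : \forall n \near F, n.+1%:R^-1 <= eta / 2 / (e + `|p| + 1).
  apply: FoO; apply: filterS (near_infty_natSinv_lt (PosNum (divr_gt0 eta20 c0))).
  by move=> n /ltW.
near F => n.
have jn := near fp n; have {}jn := jn _.
have ne : n.+1%:R^-1 <= eta / 2 / (e + `|p| + 1) by near: n.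
have nc : `|(u b - u a - (b - a) *: p) - (euler n b - euler n a - (b - a) *: p)| <= eta / 2.
  by near: n; exact: cvgr_dist_le cv _ eta20.
have {jn}nj : forall j, (j < euler_index n b - euler_index n a)%N ->
    `|f (euler_iter n (euler_index n a + j)) - p| <= e by near: n.
have := euler_iter_drift nj; rewrite subnKC ?euler_index_le//.
rewrite natrB ?euler_index_le// => drift.
have := euler_index_dist n a0 b0; set s := (_ - _) * _ in drift * => ds.
have nv : `|euler n b - euler n a - (b - a) *: p| <= s * e + n.+1%:R^-1 * `|p|.
  have -> : euler n b - euler n a - (b - a) *: p =
     (euler n b - euler n a - s *: p) + (s - (b - a)) *: p.
    by rewrite [(s - _) *: p]scalerBl addrA subrK.
  apply: le_trans (ler_normD _ _) _; apply: lerD => //.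
  by rewrite normrZ ler_wpM2r.
have se : s * e <= (b - a) * e + n.+1%:R^-1 * e.
  by rewrite -mulrDl ler_wpM2r// -lerBlDl; move: ds; rewrite ler_norml => /andP[].
move: ne; rewrite ler_pdivlMr// !mulrDr mulr1 => ne.
have h0 : 0 < n.+1%:R^-1 :> R by [].
have := ler_normD ((u b - u a - (b - a) *: p) - (euler n b - euler n a - (b - a) *: p))
   (euler n b - euler n a - (b - a) *: p).
rewrite subrK => /le_trans; apply; rewrite (mulrC e).
clearbody s; set h := n.+1%:R^-1 in ne nv se h0 *; clearbody h.
move: nc nv se ne h0; set x := `|_ - _|; set y := `|_ - _|; clearbody x y; lra.
Unshelve. all: by end_near. Qed.

Lemma euler_limit_lipschitz (a b : R) : 0 <= a -> 0 <= b -> `|u b - u a| <= M * `|b - a|.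
Proof.
have M0 : 0 <= M := le_trans (normr_ge0 _) (f_bounded z).
wlog ab : a b / a <= b => [H a0 b0|a0 b0].
  have [ab|/ltW ba] := leP a b; first exact: H.
  by rewrite distrC (distrC b); exact: H.
rewrite (ger0_norm (_ : 0 <= b - a)) ?subr_ge0//.
have := @euler_limit_drift a b 0 M; rewrite scaler0 subr0; apply => //.
  by rewrite a0.
by near=> n => j _; rewrite subr0.
Unshelve. all: by end_near. Qed.

(** Near u t the field is within e of f(u t), and for s close to t all Euler
    points between the times s and t are near u t, because they move with speed
    at most M. *)
Lemma euler_limit_is_derive (t : R) : 0 < t -> is_derive t 1 u (f (u t)).
Proof.
move=> t0; apply: is_derive_le_near => e e0.
have M0 : 0 <= M := le_trans (normr_ge0 _) (f_bounded z).
have /cvgrPdist_le/(_ e e0)/nbhs_ballP[d /= d0 fd] := @f_continuous (u t).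
have M1 : 0 < M + 1 by rewrite ltr_wpDl.
have d30 : 0 < d / 3 by rewrite divr_gt0.
(* d is shared in three: one part for the convergence at time t, two for the
   motion, which lasts at most |s - t| plus one Euler step. *)
have close n (s : R) : 0 <= s -> `|s - t| <= d / 3 / (M + 1) ->
    n.+1%:R^-1 <= d / 3 / (M + 1) -> `|u t - euler n t| < d / 3 ->
    forall a b, (a = s /\ b = t) \/ (a = t /\ b = s) -> a <= b ->
    forall j, (j < euler_index n b - euler_index n a)%N ->
    `|f (euler_iter n (euler_index n a + j)) - f (u t)| <= e.
  move=> s0 st hn cn a b abst ab j jJ.
  have a0 : 0 <= a by case: abst => -[-> _]//; exact: ltW.
  have b0 := le_trans a0 ab.
  have {}st : b - a <= d / 3 / (M + 1).
    by apply: le_trans st; case: abst => -[-> ->]; rewrite ?ler_norm// distrC ler_norm.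
  set k := euler_index n a in jJ *; set J := (_ - _)%N in jJ.
  have Jh : J%:R * n.+1%:R^-1 * M <= d / 3 * 2.
    have := euler_index_dist n a0 b0; rewrite -natrB ?euler_index_le// -/J.
    rewrite ler_norml => /andP[_]; rewrite lerBlDr => Jh.
    have {Jh} : J%:R * n.+1%:R^-1 <= d / 3 / (M + 1) * 2.
      move: st hn Jh; set D := d / 3 / _; set h := n.+1%:R^-1; set Jr := J%:R.
      by clearbody D h Jr; lra.
    move=> /(ler_wpM2r M0)/le_trans; apply.
    rewrite mulrAC ler_wpM2r// mulrAC ler_pdivrMr// ler_wpM2l ?(ltW d30)// lerDl//.
  have {Jh} dist_le i : (i <= J)%N -> i%:R * n.+1%:R^-1 * M <= d / 3 * 2.
    move=> iJ; apply: le_trans Jh; rewrite ler_wpM2r// ler_wpM2r ?(ltW (h_gt0 n))//.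
    by rewrite ler_nat.
  rewrite distrC; apply: fd; rewrite -ball_normE /=.
  have step_le : `|euler n t - euler_iter n (k + j)| <= d / 3 * 2.
    case: abst => -[? ?]; subst a b.
      have kJ : (k + j + (J - j) = euler_index n t)%N.
        by rewrite -addnA subnKC ?(ltnW jJ)// subnKC// euler_index_le.
      rewrite /euler -kJ; apply: le_trans (euler_iter_move _ _ _) _.
      by apply: dist_le; rewrite leq_subr.
    rewrite distrC; apply: le_trans (euler_iter_move _ _ _) _.
    by apply: dist_le; exact: ltnW.
  have := ler_normD (u t - euler n t) (euler n t - euler_iter n (k + j)).
  by rewrite addrA subrK => /le_lt_trans; apply; lra.
have hF : \forall n \near F, n.+1%:R^-1 <= d / 3 / (M + 1).
  apply: FoO; apply: filterS (near_infty_natSinv_lt (PosNum (divr_gt0 d30 M1))).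
  by move=> n /ltW.
have cF : \forall n \near F, `|u t - euler n t| < d / 3.
  by move/cvgrPdist_lt : (@euler_cvg t) => /(_ _ d30).
near=> s.
have s0 : 0 <= s by apply: ltW; near: s; exact: lt_nbhsr.
have st : `|s - t| <= d / 3 / (M + 1).
  near: s; apply/nbhs_normP; exists (d / 3 / (M + 1)) => /=; first exact: divr_gt0.
  by move=> s /=; rewrite distrC => /ltW.
have [ts|/ltW ts] := leP t s.
  rewrite (ger0_norm (_ : 0 <= s - t)) ?subr_ge0//.
  apply: euler_limit_drift; rewrite ?(ltW t0) ?(ltW e0)//.
  by near=> n; apply: (close n s) => //; [near: n|near: n|right].
rewrite -normrN (distrC s) (ger0_norm (_ : 0 <= t - s)) ?subr_ge0//.
rewrite (_ : - (u s - u t - _) = u t - u s - (t - s) *: f (u t)); last first.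
  by rewrite opprD opprB -scaleNr opprB.
apply: euler_limit_drift; rewrite ?s0 ?(ltW e0)//.
by near=> n; apply: (close n s) => //; [near: n|near: n|left].
Unshelve. all: by end_near. Qed.

End Limit.

(** Convergence along one ultrafilter of step sizes takes the place of the
    extraction of a uniformly convergent subsequence: by compactness the
    approximations converge along it at every time simultaneously. *)
Theorem peano_existence : exists u : R -> E, [/\ u 0 = z,
  {within [set t : R | 0 <= t], continuous u} &
  forall t : R, 0 < t -> is_derive t 1 u (f (u t))].
Proof.
have [F [FU FoO]] := @ultraFilterLemma nat \oo _.
have cvE : forall t : R, exists x : E, euler n t @[n --> F] --> x.
  move=> t.
  have M0 : 0 <= M := le_trans (normr_ge0 _) (f_bounded z).
  have [C + CM] := bounded_precompact (`|z| + (Num.max 0 t + 1) * M).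
  rewrite compact_ultra => /(_ _ (ultra_fmap (fun n => euler n t) FU)).
  case=> [|x [_ ?]]; last by exists x.
  suff : \forall n \near F, C (euler n t) by [].
  apply: nearW => n; apply: CM => /=.
  have := euler_iter_move n 0 (euler_index n t); rewrite add0n => mv.
  rewrite -[euler n t](subrK z).
  rewrite addrC (le_trans (ler_normD _ _))// lerD2l (le_trans mv)// ler_wpM2r//.
  have [t0|t0] := ltP t 0.
    have -> : euler_index n t = 0%N.
      rewrite /euler_index truncn_floor leNgt (_ : _ < 0)//.
      by rewrite pmulr_llt0.
    by rewrite mul0r addr_ge0// le_max lexx.
  have := euler_index_dist n (lexx 0) t0.
  rewrite {2}/euler_index mul0r truncn0 !subr0 ler_norml => /andP[_].
  have h1 : n.+1%:R^-1 <= 1 :> R by rewrite invf_le1// ler1n.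
  have m1 : t <= Num.max 0 t by rewrite le_max lexx orbT.
  rewrite lerBlDr => /le_trans; apply; rewrite addrC.
  exact: lerD.
have [u uP] := boolp.choice cvE.
exists u; split.
- have euler0 : (fun n => euler n 0) = cst z.
    by apply/funext => n; rewrite /euler /euler_index mul0r truncn0.
  have := uP 0; rewrite euler0 => u0.
  by apply: (cvg_unique (@norm_hausdorff _ _) u0); exact: cvg_cst.
- apply/subspace_continuousP => t /= t0; apply/cvgrPdist_le => e e0.
  have M0 : 0 <= M := le_trans (normr_ge0 _) (f_bounded z).
  have M1 : 0 < M + 1 by rewrite ltr_wpDl.
  rewrite near_withinE; near=> s => s0.
  apply: le_trans (euler_limit_lipschitz FU FoO uP s0 t0) _.
  have : `|t - s| <= e / (M + 1).
    near: s; apply/nbhs_normP; exists (e / (M + 1)) => /=; first exact: divr_gt0.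
    by move=> s /= /ltW.
  rewrite ler_pdivlMr// => /(le_trans _); apply; rewrite mulrC ler_wpM2l// lerDl//.
- by move=> t t0; exact: euler_limit_is_derive.
Unshelve. all: by end_near. Qed.

End Peano.

(** * Coordinates on phase space *)

Lemma lipschitz_continuous (R : realType) (E W : normedModType R) (f : E -> W) (C : R) :
  0 <= C -> (forall u v, `|f u - f v| <= C * `|u - v|) -> continuous f.
Proof.
move=> C0 fC u; apply/cvgrPdist_le => e e0; near=> v.
apply: le_trans (fC _ _) _.
have : `|u - v| <= e / (C + 1).
  near: v; apply/nbhs_normP; exists (e / (C + 1)) => /=.
    by rewrite divr_gt0// ltr_wpDl.
  by move=> v /= /ltW.
rewrite ler_pdivlMr ?ltr_wpDl// => /(le_trans _); apply.
by rewrite mulrC ler_wpM2l// lerDl.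
Unshelve. all: by end_near. Qed.

Section Phase.
Context {R : realType} {V : normedVectType R}.

(** The coordinate isomorphism is Lipschitz in both directions, which reduces
    the claim to row vectors. *)
Lemma bounded_precompact_normedVect (W : normedVectType R) (r : R) :
  exists2 C : set W, compact C & [set x | `|x| <= r] `<=` C.
Proof.
have [A A0 hA] := @v2r_lipschitz R W; have [B B0 hB] := @r2v_lipschitz R W.
exists (@r2v R W @` [set u | `|u| <= A * r]).
  apply: continuous_compact.
    apply: continuous_subspaceT => u.
    apply: (@lipschitz_continuous R 'rV[R]_(dim W) W _ B) => // {}u v.
    by rewrite -linearB.
  apply: bounded_closed_compact.
    exists (A * r); split; first exact: num_real.
    by move=> M rM u /= ur; rewrite (le_trans ur)// ltW.
  rewrite (_ : [set u | _] = Num.norm @^-1` [set s | s <= A * r])//.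
  apply: closed_comp; last exact: closed_le.
  by move=> u _; exact: norm_continuous.
move=> x /= xr; exists (v2r x); last exact: v2rK.
by rewrite /= (le_trans (hA x))// ler_wpM2l.
Qed.

Notation phase := (V * dual V)%type.

Lemma bounded_precompact_phase (r : R) :
  exists2 C : set phase, compact C & [set z | `|z| <= r] `<=` C.
Proof.
have [A cA rA] := @bounded_precompact_normedVect V r.
have [B cB rB] := @bounded_precompact_normedVect (dual V) r.
exists (A `*` B); first exact: compact_setX.
move=> z /=; rewrite prod_normE ge_max => /andP[z1 z2].
by split; [exact: rA|exact: rB].
Qed.

Lemma pairing_le (x : V) (y : dual V) : `|pairing x y| <= `|y| * `|x|.
Proof.
have [->|x0] := eqVneq x 0; first by rewrite /pairing linear0 !normr0 mulr0.
have nx : 0 < `|x| by rewrite normr_gt0.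
rewrite -ler_pdivrMr// dual_normE.
have -> : `|pairing x y| / `|x| = `|pairing (`|x|^-1 *: x) y|.
  by rewrite /pairing linearZ normrZ normfV normr_id mulrC.
apply: ub_le_sup; last first.
  by exists (`|x|^-1 *: x) => //=; rewrite normrZ normfV normr_id mulVf ?gt_eqF.
have [C C0 hC] := pairing_bounded y.
exists C => _ [z /= z1 <-]; apply: le_trans (hC z) _.
by rewrite -[leRHS]mulr1 ler_wpM2l.
Qed.

Lemma pairingDr (x : V) (y y' : dual V) : pairing x (y + y') = pairing x y + pairing x y'.
Proof. by rewrite /pairing add_lfunE. Qed.

Lemma pairingZr (x : V) a (y : dual V) : pairing x (a *: y) = a * pairing x y.
Proof. by rewrite /pairing scale_lfunE. Qed.

Lemma pairingNr (x : V) (y : dual V) : pairing x (- y) = - pairing x y.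
Proof. by rewrite /pairing opp_lfunE. Qed.

Lemma pairing_sumr (x : V) (I : Type) (r : seq I) (F : I -> dual V) :
  pairing x (\sum_(i <- r) F i) = \sum_(i <- r) pairing x (F i).
Proof. by rewrite /pairing sum_lfunE. Qed.

Lemma pairing_suml (y : dual V) (I : Type) (r : seq I) (F : I -> V) :
  pairing (\sum_(i <- r) F i) y = \sum_(i <- r) pairing (F i) y.
Proof. by rewrite /pairing linear_sum. Qed.

Lemma pairingZl a (x : V) (y : dual V) : pairing (a *: x) y = a * pairing x y.
Proof. by rewrite /pairing linearZ. Qed.

Lemma pairing_continuous (y : dual V) : continuous (fun x : V => pairing x y).
Proof.
apply: (@lipschitz_continuous R V R^o _ `|y|) => // u v.
by rewrite /pairing -linearB; exact: pairing_le.
Qed.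

Definition position_coord (y : dual V) (z : phase) : R^o := pairing z.1 y.

Lemma position_coord_is_linear y : linear (position_coord y).
Proof. by move=> a z z'; rewrite /position_coord /pairing /= linearP. Qed.

HB.instance Definition _ y :=
  GRing.isLinear.Build R phase R^o _ (position_coord y) (position_coord_is_linear y).

Definition momentum_coord (x : V) (z : phase) : R^o := pairing x z.2.

Lemma momentum_coord_is_linear x : linear (momentum_coord x).
Proof. by move=> a z z'; rewrite /momentum_coord /= pairingDr pairingZr. Qed.

HB.instance Definition _ x :=
  GRing.isLinear.Build R phase R^o _ (momentum_coord x) (momentum_coord_is_linear x).

Lemma position_coord_continuous y : continuous (position_coord y).
Proof.
apply: (@lipschitz_norm_continuous R phase (position_coord y) `|y|) => // u v.
rewrite -linearB (le_trans (pairing_le _ _))// ler_wpM2l//.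
by rewrite prod_normE le_max lexx.
Qed.

Lemma momentum_coord_continuous x : continuous (momentum_coord x).
Proof.
apply: (@lipschitz_norm_continuous R phase (momentum_coord x) `|x|) => // u v.
rewrite -linearB (le_trans (pairing_le _ _))// mulrC ler_wpM2l//.
by rewrite prod_normE le_max lexx orbT.
Qed.

Let d := dim V.

Definition basis (j : 'I_d) : V := @r2v R V (delta_mx 0 j).

Definition coord_form (j : 'I_d) (x : V) : R^o := v2r x 0 j.

Lemma coord_form_is_linear j : linear (coord_form j).
Proof. by move=> a x y; rewrite /coord_form linearP !mxE. Qed.

HB.instance Definition _ j :=
  GRing.isLinear.Build R V R^o _ (coord_form j) (coord_form_is_linear j).

Definition dual_basis (j : 'I_d) : dual V := linfun (coord_form j).

Lemma pairing_dual_basis x j : pairing x (dual_basis j) = v2r x 0 j.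
Proof. by rewrite /pairing lfunE. Qed.

Lemma basis_expansion x : x = \sum_j pairing x (dual_basis j) *: basis j.
Proof.
rewrite -{1}[x]v2rK {1}(row_sum_delta (v2r x)) linear_sum.
by apply: eq_bigr => j _; rewrite linearZ pairing_dual_basis.
Qed.

Lemma dual_basis_expansion y : y = \sum_j pairing (basis j) y *: dual_basis j.
Proof.
apply/lfunP => x; rewrite -!/(pairing x _) pairing_sumr.
rewrite {1}(basis_expansion x) pairing_suml; apply: eq_bigr => j _.
by rewrite pairingZl pairingZr mulrC.
Qed.

(** A polynomial that is proper on phase space: composed with cutoffs of the
    line, it gives smooth compactly supported functions. *)
Definition coord_sqnorm (z : phase) : R :=
  \sum_j pairing z.1 (dual_basis j) * pairing z.1 (dual_basis j) +
  \sum_j pairing (basis j) z.2 * pairing (basis j) z.2.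

Lemma class_C_coord_sqnorm k : class_C k setT coord_sqnorm.
Proof.
have pc y := @class_C_linear _ _ k _ (@position_coord_continuous y).
have mc x := @class_C_linear _ _ k _ (@momentum_coord_continuous x).
by apply: class_CD; apply: class_C_sum => j; apply: class_CM;
  solve [exact: pc | exact: mc].
Qed.

Lemma coord_sqnorm_bounded (r : R) : exists B, forall z, `|z| <= r -> coord_sqnorm z <= B.
Proof.
have [r0|r0] := ltP r 0.
  by exists 0 => z zr; have := le_lt_trans zr r0; rewrite normr_lt0.
exists (\sum_j (`|dual_basis j| * r) ^+ 2 + \sum_j (`|basis j| * r) ^+ 2) => z.
rewrite prod_normE ge_max => /andP[z1 z2].
apply: lerD; apply: ler_sum => j _; rewrite -expr2 -real_normK ?num_real//;
  rewrite lerXn2r ?nnegrE ?mulr_ge0// (le_trans (pairing_le _ _))//.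
  by rewrite ler_wpM2l.
by rewrite mulrC ler_wpM2l.
Qed.

Lemma coord_sqnorm_proper (B : R) : exists r, forall z, coord_sqnorm z <= B -> `|z| <= r.
Proof.
have le_sq (a : R) : `|a| <= 1 + a * a.
  rewrite -expr2 -real_normK ?num_real//; have := sqr_ge0 (`|a| - 1 / 2).
  by rewrite !expr2; lra.
have sq0 (a : R) : 0 <= a * a by rewrite -expr2 sqr_ge0.
exists (Num.max (\sum_j (1 + B) * `|basis j|) (\sum_j (1 + B) * `|dual_basis j|)).
move=> z zB; rewrite prod_normE ge_max !le_max; apply/andP; split; apply/orP.
- left; rewrite [z.1 in leLHS]basis_expansion (le_trans (ler_norm_sum _ _ _))//.
  apply: ler_sum => j _; rewrite normrZ ler_wpM2r// (le_trans (le_sq _))// lerD2l.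
  apply: le_trans zB; rewrite /coord_sqnorm (bigD1 j)//= -addrA lerDl.
  by rewrite addr_ge0// sumr_ge0.
- right; rewrite [z.2 in leLHS]dual_basis_expansion (le_trans (ler_norm_sum _ _ _))//.
  apply: ler_sum => j _; rewrite normrZ ler_wpM2r// (le_trans (le_sq _))// lerD2l.
  apply: le_trans zB; rewrite /coord_sqnorm [X in _ + X](bigD1 j)//= addrCA lerDl.
  by rewrite addr_ge0// sumr_ge0.
Qed.

(** * Trajectories of compactly supported Hamiltonians *)

(** The field (dH/dy, - dH/dx), where dH/dy, a linear form on the dual space,
    is identified with a vector through the basis. *)
Definition hamiltonian_field (h : phase -> R) (z : phase) : phase :=
  (\sum_j 'd h z (0, dual_basis j) *: basis j,
   - \sum_j 'd h z (basis j, 0) *: dual_basis j).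

Lemma omega_hamiltonian_field h z v : omega (hamiltonian_field h z) v = 'd h z v.
Proof.
rewrite /omega /hamiltonian_field /= pairingNr opprK pairing_suml pairing_sumr.
rewrite [in RHS](_ : v = \sum_j pairing (basis j) v.2 *: (0, dual_basis j) +
   \sum_j pairing v.1 (dual_basis j) *: (basis j, 0)); last first.
  have fst_sum (F : 'I_d -> phase) : (\sum_j F j).1 = \sum_j (F j).1.
    exact: (big_morph (fun z : phase => z.1)).
  have snd_sum (F : 'I_d -> phase) : (\sum_j F j).2 = \sum_j (F j).2.
    exact: (big_morph (fun z : phase => z.2)).
  rewrite [LHS]surjective_pairing [RHS]surjective_pairing /=.
  rewrite !fst_sum !snd_sum /=.
  under eq_bigr do rewrite scaler0.
  under [X in (_, _ + X)]eq_bigr do rewrite scaler0.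
  by rewrite !big1_eq add0r addr0 -basis_expansion -dual_basis_expansion.
rewrite linearD !linear_sum; congr (_ + _); apply: eq_bigr => j _.
  by rewrite linearZ pairingZl mulrC.
by rewrite linearZ pairingZr mulrC.
Qed.

Lemma hamiltonian_field_continuous h : class_C 1 setT h ->
  continuous (hamiltonian_field h).
Proof.
move=> [_ dh] z; have cd v : {for z, continuous (fun z => 'd h z v)} by exact: dh.
pose A z : V := \sum_j 'd h z (0, dual_basis j) *: basis j.
pose B z : dual V := - \sum_j 'd h z (basis j, 0) *: dual_basis j.
have cA : A z @[z --> z] --> A z.
  apply: cvg_big => [|j _]; first exact: add_continuous.
  exact: cvgZr_tmp (cd _).
have cB : B z @[z --> z] --> B z.
  apply: cvgN; apply: cvg_big => [|j _]; first exact: add_continuous.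
  exact: cvgZr_tmp (cd _).
exact: (@cvg_pair _ _ _ _ (nbhs (A z)) (nbhs (B z)) _ _ _ A B cA cB).
Qed.

Lemma diff_near_eq (f g : phase -> R) z v : differentiable f z -> differentiable g z ->
  (\near z, f z = g z) -> 'd f z v = 'd g z v.
Proof. by move=> df dg fg; rewrite -!deriveE//; exact: near_eq_derive. Qed.

(** Outside the closed set C the function vanishes locally, hence so does its
    field; on C the field is bounded by compactness. *)
Lemma hamiltonian_field_bounded h (C : set phase) : class_C 1 setT h -> compact C ->
  (forall z, ~ C z -> h z = 0) -> exists M, forall z, `|hamiltonian_field h z| <= M.
Proof.
move=> hC1 cC h0; have ch := hamiltonian_field_continuous hC1.
have [M [_ bM]] : bounded_set (hamiltonian_field h @` C).
  apply: compact_bounded; apply: continuous_compact => //.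
  exact: continuous_subspaceT.
exists (Num.max 0 (M + 1)) => z; rewrite le_max.
have [Cz|nCz] := pselect (C z).
  by apply/orP; right; apply: (bM (M + 1)); [rewrite ltrDl|exists z].
have d0 v : 'd h z v = 0.
  have -> : 'd h z v = 'd (cst 0 : phase -> R) z v.
    apply: diff_near_eq; [exact: hC1.1|exact: differentiable_cst|].
    have oC : open (~` C).
      by apply: closed_openC; apply: compact_closed => //; exact: norm_hausdorff.
    have : nbhs z (~` C) by exact: open_nbhs_nbhs.
    by apply: filterS => z' /h0.
  by rewrite diff_cst.
rewrite /hamiltonian_field; under eq_bigr do rewrite d0 scale0r.
under [X in (_, - X)]eq_bigr do rewrite d0 scale0r.
by rewrite !big1_eq oppr0 prod_normE /= !normr0 maxxx lexx.
Qed.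

Lemma hamiltonian_trajectory h (C : set phase) z : class_C 1 setT h -> compact C ->
  (forall z, ~ C z -> h z = 0) ->
  exists u : R -> phase, [/\ u 0 = z, {within `[0, 1], continuous u} &
   forall t : R, t \in `]0, 1[ -> derivable u t 1 /\
     forall v, omega (derive1 u t) v = 'd h (u t) v].
Proof.
move=> hC1 cC h0; have [M hM] := hamiltonian_field_bounded hC1 cC h0.
have [u [u0 cu du]] := @peano_existence R phase (hamiltonian_field h) M z
  bounded_precompact_phase (hamiltonian_field_continuous hC1) hM.
exists u; split => //.
  by apply: continuous_subspaceW cu => t /=; rewrite in_itv /= => /andP[].
move=> t; rewrite in_itv /= => /andP[t0 _]; have [dut duE] := du t t0.
by split=> // v; rewrite derive1E duE omega_hamiltonian_field.
Qed.

End Phase.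

(** * Planks as strips *)

Section Strips.
Context {R : realType} {V : normedVectType R}.

(** Moving x along a vector x0 that is transverse to the plank reaches both
    bounding hyperplanes, where the unit normal takes its two constant values;
    its value at x lies between them as the unit normal is affine along x0. A
    functional of norm 1 separates the values by at most the distance of the
    hyperplanes. *)
Lemma plank_strip (P : plank V) (n : dual V) : unit_normal P n ->
  exists a b, [/\ a <= b, b - a <= plank_width P &
    forall x, plank_set P x -> a <= pairing x n <= b].
Proof.
case=> n1 [c lowerE] [c' upperE].
have [x0 x0P] : exists x0, pairing x0 (plank_dir P) = 1.
  apply: contrapT => nex; have /negP := plank_dir_neq0 P; apply; apply/eqP/lfunP => x.
  rewrite zero_lfunE -/(pairing x (plank_dir P)); apply: contrapT => /eqP px.
  apply: nex; exists ((pairing x (plank_dir P))^-1 *: x).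
  by rewrite pairingZl mulVf.
have lohi := plank_lo_le_hi P.
have lowerP x : pairing x (plank_dir P) = plank_lo P -> pairing x n = c.
  by move=> xP; have : plank_lower P x by []; rewrite lowerE.
have upperP x : pairing x (plank_dir P) = plank_hi P -> pairing x n = c'.
  by move=> xP; have : plank_upper P x by []; rewrite upperE.
have pD x y (t : R) (k : dual V) : pairing (x + t *: y) k = pairing x k + t * pairing y k.
  by rewrite /pairing linearD linearZ.
have width : `|c' - c| <= plank_width P.
  apply: lb_le_inf.
    exists `|plank_lo P *: x0 - plank_hi P *: x0|.
    exists (plank_lo P *: x0); first by rewrite /plank_lower/hyperplane/= pairingZl x0P mulr1.
    exists (plank_hi P *: x0) => //.
    by rewrite /plank_upper/hyperplane/= pairingZl x0P mulr1.
  move=> _ [x xl [x' xu <-]]; rewrite -(lowerP _ xl) -(upperP _ xu).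
  rewrite -[`|x - x'|]mul1r -n1 distrC; apply: le_trans (pairing_le _ _).
  by rewrite /pairing linearB.
have strip x : plank_set P x -> Num.min c c' <= pairing x n <= Num.max c c'.
  move=> /andP[lox xhi].
  have := lowerP (x + (plank_lo P - pairing x (plank_dir P)) *: x0).
  rewrite !pD x0P mulr1 subrKC => /(_ erefl) <-.
  have := upperP (x + (plank_hi P - pairing x (plank_dir P)) *: x0).
  rewrite !pD x0P mulr1 subrKC => /(_ erefl) <-.
  set s := pairing x (plank_dir P) in lox xhi *; set p := pairing x n.
  set q := pairing x0 n.
  rewrite ge_min le_max; have [q0|/ltW q0] := leP 0 q.
    apply/andP; split; apply/orP; [left|right].
      by rewrite gerDl mulr_le0_ge0// subr_le0.
    by rewrite lerDl mulr_ge0// subr_ge0.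
  apply/andP; split; apply/orP; [right|left].
    by rewrite gerDl mulr_ge0_le0// subr_ge0.
  by rewrite lerDl mulr_le0// subr_le0.
exists (Num.min c c'), (Num.max c c'); split => //.
- by rewrite ge_min !le_max lexx.
- by apply: le_trans width; rewrite maxr_absE minr_absE distrC; lra.
Qed.

End Strips.

(** * Displacement by shears *)

Section Displacement.
Context {R : realType} {V : normedVectType R}.
Notation phase := (V * dual V)%type.

Lemma diff_sum (m : nat) (f : 'I_m -> V -> R) x v :
  (forall i, differentiable (f i) x) ->
  'd (fun x => \sum_i f i x) x v = \sum_i 'd (f i) x v.
Proof.
move=> df; have -> : (fun x => \sum_i f i x) = \sum_i f i by rewrite -fct_sumE.
rewrite -deriveE; last exact: differentiable_sum.
rewrite derive_sum; last by move=> i; exact: diff_derivable.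
by apply: eq_bigr => i _; rewrite deriveE.
Qed.

Lemma total_oscillation_autonomous_le (h : phase -> R) (A : R) :
  (forall z, 0 <= h z <= A) ->
  (total_oscillation (fun z (_ : R) => h z) 0 1 <= A%:E)%E.
Proof.
move=> hA; rewrite /total_oscillation.
have ne : range h !=set0 by exists (h 0); exists 0.
rewrite integral_cst//= lebesgue_measure_itv/= lte_fin ltr01 oppr0 adde0 mule1 lee_fin.
rewrite -[leRHS]subr0; apply: lerB.
  by apply: ge_sup => // _ [z _ <-]; have /andP[] := hA z.
by apply: lb_le_inf => // _ [z _ <-]; have /andP[] := hA z.
Qed.

(** The shear (x, y) |-> (x, y - t g(x)) generated by F moves the fibre over
    each x in K by a vector longer than the diameter of the dual ball, so its
    time-one map displaces K x B°. Multiplying F by a cutoff that equals 1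
    around the set swept by K x B° makes the Hamiltonian compactly supported;
    since 0 lies in [0, A], this does not enlarge the range. The trajectories
    that start in K x B° never leave the region where the cutoff is 1, hence
    are still those of the shear; the other ones only have to exist. *)
Lemma displacement_energy_potential (K : set V) (F : V -> R) (g : V -> dual V)
    (A : R) :
  compact K -> smooth F -> (forall x v, 'd F x v = pairing v (g x)) ->
  (forall x, 0 <= F x <= A) -> (forall x, K x -> 2 < `|g x|) ->
  (displacement_energy (K `*` dual_ball V) <= A%:E)%E.
Proof.
move=> cK Fk dF F0A g2.
have cg : continuous g.
  rewrite (_ : g = fun x => \sum_j 'd F x (basis j) *: dual_basis j); last first.
    apply/funext => x; rewrite [LHS]dual_basis_expansion.
    by apply: eq_bigr => j _; rewrite dF.
  move=> x; apply: cvg_big => [|j _]; first exact: add_continuous.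
  by apply: cvgZr_tmp; have [_ /(_ (basis j))] := Fk 1%N; exact.
have [Mg MgP] : exists M, forall x, K x -> `|g x| <= M.
  have [M [_ bM]] : bounded_set (g @` K).
    apply: compact_bounded; apply: continuous_compact => //.
    exact: continuous_subspaceT.
  exists (M + 1) => x Kx; apply: (bM (M + 1)); first by rewrite ltrDl.
  by exists x.
have [MK MKP] : exists M, forall x, K x -> `|x| <= M.
  have [M [_ bM]] := compact_bounded cK.
  by exists (M + 1) => x Kx; apply: (bM (M + 1)) => //; rewrite ltrDl.
pose shear (z : phase) (t : R) : phase := (z.1, z.2 - t *: g z.1).
have [B BP] := @coord_sqnorm_bounded R V (Num.max MK (1 + Mg)).
have shearB z t : (K `*` dual_ball V) z -> 0 <= t <= 1 -> coord_sqnorm (shear z t) <= B.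
  move=> [Kz Bz] /andP[t0 t1]; apply: BP; rewrite prod_normE ge_max !le_max.
  rewrite /= MKP//=; apply/orP; right.
  rewrite (le_trans (ler_normB _ _))// lerD//.
  by rewrite normrZ ger0_norm// (le_trans _ (MgP _ Kz))// ler_piMl.
(* The cutoff is 1 up to B + 1, not just up to B, so that it is constant on a
   neighbourhood of the swept set and does not contribute to the derivative. *)
have [chi [chik chi01 chi1 chi0]] := smooth_cutoff (B + 1).
pose H z := chi (coord_sqnorm z) * F z.1.
have cfst : continuous (fst : phase -> V) by move=> z; exact: cvg_fst.
have F1k k : class_C k setT (fun z : phase => F z.1).
  exact: (@class_C_comp_linear R phase V k (fst : {linear phase -> V}) F cfst).
have dF1 z v : 'd (fun z : phase => F z.1) z v = pairing v.1 (g z.1).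
  have dfst : is_diff z (fst : phase -> V) (fst : phase -> V).
    exact: (@linear_is_diff R phase V (fst : {linear phase -> V}) z cfst).
  have [_ ->] := is_diff_comp dfst (class_C_is_diff (Fk 1%N) z.1).
  by rewrite /= dF.
have Hk k : class_C k setT H.
  apply: class_CM; last exact: F1k.
  exact: class_C_comp (chik k) (@class_C_coord_sqnorm _ _ k).
have [r rP] := @coord_sqnorm_proper R V (B + 1 + 1).
have [C cC rC] := @bounded_precompact_phase R V r.
have H0 z : ~ C z -> H z = 0.
  move=> nCz; rewrite /H chi0 ?mul0r// leNgt; apply/negP => /ltW/rP/rC//.
have H0A z : 0 <= H z <= A.
  have /andP[F0 FA] := F0A z.1; have /andP[c0 c1] := chi01 (coord_sqnorm z).
  by rewrite /H mulr_ge0//= (le_trans _ FA)// ler_piMl.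
have [u uP] := boolp.choice (fun z => hamiltonian_trajectory z (Hk 1%N) cC H0).
pose phi (t : R) (z : phase) : phase :=
  if pselect ((K `*` dual_ball V) z) then shear z t else u z t.
have dshear z (t : R) : is_derive t 1 (shear z) (0, - g z.1).
  apply: is_derive_le_near => e e0; near=> s.
  suff -> : shear z s - shear z t - (s - t) *: ((0, - g z.1) : phase) = 0.
    by rewrite normr0 mulr_ge0// ltW.
  rewrite /shear; congr (_, _) => /=.
    by rewrite scaler0 subr0 subrr.
  rewrite scalerN opprK scalerBl opprB addrA [z.2 - _]addrC.
  by rewrite [_ - z.2]addrC [_ + z.2 + _]addrA addrK [- _ + _]addrC subrK subrr.
have flow : hamiltonian_flow (fun z (_ : R) => H z) 0 1 phi.
  split=> [z|z|z t]; rewrite /phi; case: pselect => Xz.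
  - by rewrite /shear scale0r subr0 -surjective_pairing.
  - by have [] := uP z.
  - apply: continuous_subspaceT => t; apply: differentiable_continuous.
    by apply/derivable1_diffP; have [] := dshear z t.
  - by have [] := uP z.
  - rewrite in_itv/= => /andP[t0 t1]; have [dl dlE] := dshear z t.
    split=> // v; rewrite derive1E dlE /omega /= pairingNr opprK.
    rewrite /pairing linear0 add0r -/(pairing _ _).
    rewrite -[LHS](dF1 (shear z t)).
    apply: diff_near_eq; [exact: (F1k 1%N).1|exact: (Hk 1%N).1|].
    have qB : coord_sqnorm (shear z t) < B + 1.
      by rewrite (le_lt_trans (shearB _ _ Xz _)) ?ltrDl// (ltW t0) (ltW t1).
    have cq := class_C_continuous (@class_C_coord_sqnorm R V 0).
    have : \forall w \near shear z t, coord_sqnorm w < B + 1.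
      exact: (cq (shear z t) _ (lt_nbhsl qB)).
    by apply: filterS => w wB; rewrite /H chi1 ?mul1r// ltW.
  - by have [_ _] := uP z; exact.
have disp : displaces (fun z (_ : R) => H z) 0 1 (K `*` dual_ball V).
  exists phi => //; rewrite -subset0 => _ [/[swap] [[z Xz <-]]].
  rewrite /phi; case: pselect => // _ [_ /= yB].
  have := g2 _ Xz.1; rewrite ltNge => /negP; apply.
  have -> : g z.1 = z.2 - (z.2 - 1 *: g z.1) by rewrite opprB addrC subrK scale1r.
  apply: le_trans (ler_normB _ _) _; rewrite -[2]/(1 + 1).
  by apply: lerD; [exact: Xz.2|exact: yB].
apply: le_trans (total_oscillation_autonomous_le H0A).
apply: ereal_inf_lbound; exists (fun z _ => H z), 0, 1; split => //.
- move=> k.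
  apply: (@class_C_comp_linear R _ _ k (fst : {linear (phase * R^o)%type -> phase}) H).
    by move=> p; exact: cvg_fst.
  exact: Hk.
- by exists C => // z t _; exact: H0.
Unshelve. all: by end_near. Qed.

(** The potential is l times the sum of nondecreasing clamps of the
    functionals n i. Its gradient at x is l times a nonnegative combination of
    the n i, in which n i has coefficient 1 when x is in the i-th strip; over K
    the hypothesis on the n i thus makes it at least l > 2 in norm. *)
Lemma displacement_energy_strips (K : set V) (m : nat) (n : 'I_m -> dual V)
    (a b : 'I_m -> R) (d l : R) :
  compact K -> (forall i, a i <= b i) -> 0 < d -> 2 < l ->
  (forall x, K x -> exists i, a i <= pairing x (n i) <= b i) ->
  (forall c : 'I_m -> R, (forall i, 0 <= c i) -> (exists i, c i = 1) ->
     1 <= `|\sum_i c i *: n i|) ->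
  (displacement_energy (K `*` dual_ball V) <=
     (\sum_i l * (b i - a i + 4 * d))%:E)%E.
Proof.
move=> cK ab d0 l2 Kcov n_sum.
have l0 : 0 < l by apply: lt_trans l2.
have [h hP] := boolp.choice (fun i => smooth_clamp (ab i) d0).
have hk i k : class_C k setT (h i) by have [] := hP i; exact.
pose slope i (s : R) : R := 'd (h i) s 1.
have dh i (s : R) : is_derive s 1 (h i) (slope i s).
  have dhs : differentiable (h i) s := (hk i 1%N).1 s I.
  by split; [exact: diff_derivable|rewrite deriveE].
have slope_ge0 i (s : R) : 0 <= slope i s.
  by have [_ hm _ _] := hP i; exact: nondecreasing_derive_ge0 hm (dh i s).
have slope1 i (s : R) : a i <= s <= b i -> slope i s = 1.
  move=> /andP[as_ sb]; have [_ _ _ hid] := hP i.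
  have near_id : \near s, s - (a i - 2 * d) = h i s.
    near=> t; rewrite hid//; apply/andP; split.
      by near: t; apply: lt_nbhsr; rewrite ltrBlDr (le_lt_trans as_)// ltrDl.
    by near: t; apply: lt_nbhsl; rewrite (le_lt_trans sb)// ltrDl.
  have ddh : is_derive s 1 (h i) 1.
    apply: near_eq_is_derive near_id _.
    have := is_deriveB (is_derive_id s (1 : R)) (is_derive_cst (a i - 2 * d) s (1 : R)).
    by rewrite subr0.
  by have [_ <-] := dh i s; have [_ ->] := ddh.
pose F (x : V) := \sum_i l * h i (pairing x (n i)).
pose g (x : V) : dual V := l *: \sum_i slope i (pairing x (n i)) *: n i.
have Lk y k : class_C k setT (fun x : V => pairing x y).
  exact: (@class_C_linear _ _ k (y : 'Hom(V, R^o)) (@pairing_continuous R V y)).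
have termk i k : class_C k setT (fun x => l * h i (pairing x (n i))).
  apply: class_CM; first exact: class_C_cst.
  exact: class_C_comp (hk i k) (Lk (n i) k).
apply: (@displacement_energy_potential K F g) => //.
- by move=> k; exact: class_C_sum.
- move=> x v; rewrite diff_sum => [|i]; last exact: (termk i 1%N).1.
  rewrite pairingZr pairing_sumr mulr_sumr; apply: eq_bigr => i _; rewrite pairingZr.
  have dL : is_diff x (fun x => pairing x (n i)) (fun v => pairing v (n i)).
    exact: (@linear_is_diff R V R^o (n i : 'Hom(V, R^o)) x (@pairing_continuous R V (n i))).
  have [_ ->] := is_diffZ l (is_diff_comp dL
    (is_diff_of_derive (dh i (pairing x (n i))))).
  by [].
- move=> x; apply/andP; split.
    apply: sumr_ge0 => i _; have [_ _ /(_ (pairing x (n i)))/andP[h0 _] _] := hP i.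
    by rewrite mulr_ge0// ltW.
  apply: ler_sum => i _; have [_ _ /(_ (pairing x (n i)))/andP[_ hA] _] := hP i.
  by rewrite ler_pM2l.
- move=> x /Kcov[i iab]; rewrite normrZ gtr0_norm//.
  have := n_sum (fun i => slope i (pairing x (n i))) (fun i => slope_ge0 _ _)
    (ex_intro _ i (slope1 _ _ iab)).
  by rewrite -(ler_pM2l l0) mulr1; exact: lt_le_trans.
Unshelve. all: by end_near. Qed.

End Displacement.

Theorem theorem2p2 (R : realType) (V : normedVectType R) (k : nat)
    (k_ge1 : (1 <= k)%N)
    (norm_smooth : smooth_norm k V) (dual_norm_smooth : smooth_norm k (dual V))
    (K : set V) (K_body : convex_body K)
    (m : nat) (P : 'I_m -> plank V)
    (K_covered : K `<=` \bigcup_(i in [set: 'I_m]) plank_set (P i))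
    (n : 'I_m -> dual V) (n_normal : forall i, unit_normal (P i) (n i))
    (n_sum : forall c : 'I_m -> R,
       (forall i, 0 <= c i) -> (exists i, c i = 1) ->
       1 <= `|\sum_(i < m) c i *: n i|) :
  (displacement_energy (K `*` dual_ball V) <=
     (2 * \sum_(i < m) plank_width (P i))%:E)%E.
Proof.
have [cK _ _] := K_body.
have [a aP] := boolp.choice (fun i => plank_strip (n_normal i)).
have [b abP] := boolp.choice aP.
have ab i : a i <= b i by have [] := abP i.
set w := \sum_i _; have w0 : 0 <= w.
  by apply: sumr_ge0 => i _; have [abi + _] := abP i; apply: le_trans; rewrite subr_ge0.
have Kcov x : K x -> exists i, a i <= pairing x (n i) <= b i.
  by move=> /K_covered[i _ xi]; exists i; have [_ _] := abP i; exact.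
apply/lee_addgt0Pr => e e0.
have D0 : 0 < 2 * w + 16 * m%:R + 1 by rewrite ltr_wpDl// addr_ge0// mulr_ge0.
(* With d <= 1, the bound (2 + 2d)(w + 4md) exceeds 2w by at most
   d (2w + 16m). *)
pose d := Num.min 1 (e / (2 * w + 16 * m%:R + 1)).
have d0 : 0 < d by rewrite lt_min ltr01 divr_gt0.
have l2 : 2 < 2 + 2 * d by rewrite ltrDl mulr_gt0.
apply: le_trans (displacement_energy_strips cK ab d0 l2 Kcov n_sum) _.
rewrite -EFinD lee_fin -mulr_sumr.
have sum_le : \sum_i (b i - a i + 4 * d) <= w + m%:R * (4 * d).
  rewrite big_split /= lerD//; first by apply: ler_sum => i _; have [] := abP i.
  by rewrite sumr_const card_ord [leRHS]mulr_natl.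
have d1 : d <= 1 by rewrite ge_min lexx.
have de : d * (2 * w + 16 * m%:R + 1) <= e.
  by rewrite -ler_pdivlMr// ge_min lexx orbT.
have l0 : 0 <= 2 + 2 * d by apply: ltW; apply: lt_trans l2.
apply: le_trans (ler_wpM2l l0 sum_le) _.
have dm : 0 <= m%:R * d * (1 - d) by rewrite mulr_ge0 ?subr_ge0// mulr_ge0// ltW.
by move: (ltW d0) dm de; clearbody d w; move: (m%:R : R) => M; lra.
Qed.
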